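(* Let $X$ be a flat Hadamard space with linear dual space $X^{\lozenge}$, and let $p\in X$. Then there is a one-to-one correspondence (a bijection) between the set $\mathfrak M(X)$ of all maximal monotone operators $T:X\multimap X^{\lozenge}$ and the set $\Gamma_p^{\lozenge}(X)$.
   Context: A Hadamard space is a (nonempty) complete $\mathrm{CAT}(0)$ space $(X,d)$. For $x,y\in X$ and $t\in[0,1]$, $(1-t)x\oplus ty$ denotes the point $c(t)$ of the unique constant-speed geodesic $c:[0,1]\to X$ from $x$ to $y$. $X$ is flat if $d(z,(1-t)x\oplus ty)^2=(1-t)d(z,x)^2+td(z,y)^2-t(1-t)d(x,y)^2$ for all $x,y,z\in X$, $t\in[0,1]$. Quasilinearization: for $x,y,u,v\in X$, $\langle\overrightarrow{xy},\overrightarrow{uv}\rangle:=\frac12\big(d(x,v)^2+d(y,u)^2-d(x,u)^2-d(y,v)^2\big)$. Dual spaces: for $t\in\mathbb R$, $a,b\in X$, $[t\overrightarrow{ab}]$ is the class of $(t,a,b)\in\mathbb R\times X^2$ under the relation $(t,a,b)\sim(s,c,d)$ iff $t\langle\overrightarrow{ab},\overrightarrow{xy}\rangle=s\langle\overrightarrow{cd},\overrightarrow{xy}\rangle$ for all $x,y\in X$; it is identified with the function $\overrightarrow{xy}\mapsto t\langle\overrightarrow{ab},\overrightarrow{xy}\rangle$ on $X^2$. $X^*$ is the set of all such classes, and the linear dual $X^{\lozenge}$ is the real vector space of all finite linear combinations $\sum_i\alpha_i x_i^*$ ($\alpha_i\in\mathbb R$, $x_i^*\in X^*$), acting on $X^2$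 by $\langle\sum_i\alpha_ix_i^*,\overrightarrow{xy}\rangle=\sum_i\alpha_i\langle x_i^*,\overrightarrow{xy}\rangle$ (elements with the same action are equal). $X^{\lozenge}$ carries the norm $\|x^{\lozenge}\|_{\lozenge}=\sup\Big\{\frac{|\langle x^{\lozenge},\overrightarrow{ab}\rangle-\langle x^{\lozenge},\overrightarrow{cd}\rangle|}{d(a,b)+d(c,d)}: a,b,c,d\in X,\ (a,c)\ne(b,d)\Big\}$, and $X\times X^{\lozenge}$ the product topology. For $h:X\times X^{\lozenge}\to[-\infty,\infty]$: $h$ is proper if it never takes the value $-\infty$ and $h\not\equiv\infty$; l.s.c. if its epigraph is closed; convex if $h((1-\lambda)x\oplus\lambda y,(1-\lambda)x^{\lozenge}+\lambda y^{\lozenge})\le(1-\lambda)h(x,x^{\lozenge})+\lambda h(y,y^{\lozenge})$ for all $(x,x^{\lozenge}),(y,y^{\lozenge})$ and $\lambda\in[0,1]$. $\Gamma(X\times X^{\lozenge})$ is the set of proper, l.s.c., convex $h:X\times X^{\lozenge}\to[-\infty,\infty]$. Fix $p\in X$. $\pi_p(x,x^{\lozenge}):=\langle x^{\lozenge},\overrightarrow{px}\rangle$ on $X\times X^{\lozenge}$; $r(x,x^{\lozenge}):=(x^{\lozenge},x)$. The indicator $\iota_A$ equals $0$ on $A$ and $\infty$ off $A$. $\{h\le\pi_p\}:=\{(x,x^{\lozenge}):h(x,x^{\lozenge})\le\pi_p(x,x^{\lozenge})\}$. The $p$-Fenchel conjugate $h_p^{\lozenge}:X^{\lozenge}\times X\to[-\infty,\infty]$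 is $$h_p^{\lozenge}(x^{\lozenge},x)=\sup_{(y,y^{\lozenge})\in X\times X^{\lozenge}}\{\langle x^{\lozenge},\overrightarrow{py}\rangle+\langle y^{\lozenge},\overrightarrow{px}\rangle-h(y,y^{\lozenge})\}.$$ $\Gamma_p^{\lozenge}(X):=\{h\in\Gamma(X\times X^{\lozenge}): h=(h+\iota_{\{h\le\pi_p\}})_p^{\lozenge}\circ r\text{ on }X\times X^{\lozenge}\}$. For a set-valued operator $T:X\multimap X^{\lozenge}$ (a map assigning to each $x\in X$ a possibly empty subset $T(x)\subseteq X^{\lozenge}$), $\mathrm{gra}(T)=\{(x,x^{\lozenge}):x^{\lozenge}\in T(x)\}$. $T$ is monotone if $\langle x^{\lozenge}-y^{\lozenge},\overrightarrow{yx}\rangle\ge0$ for all $(x,x^{\lozenge}),(y,y^{\lozenge})\in\mathrm{gra}(T)$; it is maximal monotone if it is monotone and no monotone operator has a graph properly containing $\mathrm{gra}(T)$. *)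

(* Defs.v *)
From HB Require Import structures.
From mathcomp Require Import all_boot all_order all_algebra.
From mathcomp Require Import ring lra.
From mathcomp Require Import all_classical all_reals all_analysis.

Set Implicit Arguments.
Unset Strict Implicit.
Unset Printing Implicit Defensive.

Import Order.TTheory GRing.Theory Num.Theory.
Import numFieldNormedType.Exports.

Local Open Scope classical_set_scope.
Local Open Scope ring_scope.

Section cat0.
Context {R : realType} {X : metricType R}.
Implicit Types x y z : X.

(* Constant-speed geodesic c : [0, 1] -> X from x to y; the values of c outside
   [0, 1] are irrelevant. *)
Definition geodesic (c : R -> X) x y : Prop :=
  [/\ c 0 = x, c 1 = y &
      forall s t, 0 <= s <= 1 -> 0 <= t <= 1 ->
        mdist (c s) (c t) = `|s - t| * mdist x y].

(* Euclidean distance of the plane (the library norm on pairs is the sup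
   norm). *)
Definition edist (u v : R^o * R^o) : R :=
  Num.sqrt ((u.1 - v.1) ^+ 2 + (u.2 - v.2) ^+ 2).

Definition comparison_triangle x y z (x' y' z' : R^o * R^o) : Prop :=
  [/\ edist x' y' = mdist x y, edist x' z' = mdist x z
    & edist y' z' = mdist y z].

(* Geodesic triangles are not fatter than their comparison triangles. Two
   points on distinct sides lie on two sides with a common vertex, called x
   here; for two points on the same side there is nothing to require. *)
Definition is_cat0 : Prop :=
  (forall x y, exists c, geodesic c x y) /\
  (forall x y z (c c' : R -> X) (x' y' z' : R^o * R^o),
     geodesic c x y -> geodesic c' x z -> comparison_triangle x y z x' y' z' ->
     forall s t, 0 <= s <= 1 -> 0 <= t <= 1 ->
       mdist (c s) (c' t) <=
       edist ((1 - s) *: x' + s *: y') ((1 - t) *: x' + t *: z')).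

(* The point (1 - t) x (+) t y. In a CAT(0) space it does not depend on the
   choice of the geodesic; [x] is only a default value. *)
Definition geo x y (t : R) : X :=
  xget x [set z | exists2 c, geodesic c x y & z = c t].

Definition quasilin x y u v : R :=
  2^-1 * (mdist x v ^+ 2 + mdist y u ^+ 2 - mdist x u ^+ 2 - mdist y v ^+ 2).

Definition flat : Prop := forall x y z t, 0 <= t <= 1 ->
  mdist z (geo x y t) ^+ 2 =
  (1 - t) * mdist z x ^+ 2 + t * mdist z y ^+ 2 - t * (1 - t) * mdist x y ^+ 2.

End cat0.
Arguments is_cat0 {R} X.
Arguments flat {R} X.

HB.mixin Record isCAT0 (R : realType) X & Metric R X := {
  cat0_subproof : is_cat0 X
}.

(* Nonemptiness is part of [Complete], which includes a point. *)
#[short(type="hadamardType")]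
HB.structure Definition Hadamard (R : realType) :=
  { X of Metric R X & Complete X & isCAT0 R X }.

Section cat0_theory.
Context {R : realType} {X : hadamardType R}.
Implicit Types x y z : X.

Lemma edist_sqr (u v : R^o * R^o) :
  edist u v ^+ 2 = (u.1 - v.1) ^+ 2 + (u.2 - v.2) ^+ 2.
Proof. by rewrite sqr_sqrtr// addr_ge0// sqr_ge0. Qed.

Lemma edistE (u v : R^o * R^o) (d : R) : 0 <= d ->
  (u.1 - v.1) ^+ 2 + (u.2 - v.2) ^+ 2 = d ^+ 2 -> edist u v = d.
Proof. by move=> d0; rewrite /edist => ->; rewrite sqrtr_sqr ger0_norm. Qed.

Lemma comparison_triangle_ex x y z :
  exists u v w : R^o * R^o, comparison_triangle x y z u v w.
Proof.
have [xy|xy] := eqVneq x y.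
  subst y; exists (0, 0), (0, 0), (mdist x z, 0); split.
  - by apply: edistE; rewrite ?mdist_ge0//= mdistxx; ring.
  - by apply: edistE; rewrite ?mdist_ge0//=; ring.
  - by apply: edistE; rewrite ?mdist_ge0//=; ring.
have a0 : 0 < mdist x y by rewrite mdist_gt0.
have t1 := metric_triangle y x z; have t2 := metric_triangle x z y.
have t3 := metric_triangle x y z.
rewrite (metric_sym y x) in t1; rewrite (metric_sym z y) in t2.
move: (mdist_ge0 x z) (mdist_ge0 y z).
rewrite /comparison_triangle.
set a := mdist x y in a0 t1 t2 t3 *; set b := mdist x z in t1 t2 t3 *.
set c := mdist y z in t1 t2 t3 *; move=> b0 c0.
pose u := (a ^+ 2 + b ^+ 2 - c ^+ 2) / (2 * a).
have au : 2 * a * u = a ^+ 2 + b ^+ 2 - c ^+ 2.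
  by rewrite /u mulrC divfK// mulf_neq0// gt_eqF.
have ub : u <= b by rewrite -(ler_pM2l a0); nra.
have bu : - b <= u by rewrite -(ler_pM2l a0); nra.
have v0 : 0 <= b ^+ 2 - u ^+ 2 by nra.
exists (0, 0), (a, 0), (u, Num.sqrt (b ^+ 2 - u ^+ 2)); split.
- by apply: edistE => /=; [exact: ltW|ring].
- by apply: edistE => //=; rewrite !sub0r !sqrrN sqr_sqrtr//; ring.
- apply: edistE => //=; rewrite sub0r sqrrN sqr_sqrtr//.
  by rewrite sqrrB -mulr_natl; lra.
Qed.

Lemma cat0_cn x y z (c : R -> X) t : geodesic c x y -> 0 <= t <= 1 ->
  mdist z (c t) ^+ 2 <= (1 - t) * mdist z x ^+ 2 + t * mdist z y ^+ 2
                        - t * (1 - t) * mdist x y ^+ 2.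
Proof.
move=> cxy t01; have [geoX catX] := @cat0_subproof R X.
have [c' c'xz] := geoX x z.
have [x' [y' [z' [Exy Exz Eyz]]]] := comparison_triangle_ex x y z.
have i1 : 0 <= (1 : R) <= 1 by rewrite ler01 lexx.
have := catX x y z c c' x' y' z' cxy c'xz (And3 Exy Exz Eyz) t 1 t01 i1.
have [_ -> _] := c'xz; rewrite (metric_sym (c t)) => H.
have {H} : mdist z (c t) ^+ 2 <=
    edist ((1 - t) *: x' + t *: y') ((1 - 1) *: x' + 1 *: z') ^+ 2.
  by rewrite ler_sqr// nnegrE ?mdist_ge0// sqrtr_ge0.
move=> /le_trans; apply; rewrite edist_sqr (metric_sym z x) (metric_sym z y).
rewrite -Exy -Exz -Eyz !edist_sqr /=.
case: x' y' z' {Exy Exz Eyz} => [x1 x2] [y1 y2] [z1 z2] /=.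
rewrite le_eqVlt; apply/orP; left; apply/eqP.
by rewrite /GRing.scale/=; ring.
Qed.

Lemma quasilin_CS x y u v : `|quasilin x y u v| <= mdist x y * mdist u v.
Proof.
suff H (a b c d : X) : quasilin a b c d <= mdist a b * mdist c d.
  rewrite ler_norml H andbT lerNl (metric_sym x y).
  by apply: le_trans (H y x u v); rewrite /quasilin; lra.
have [<-|ab] := eqVneq a b; first by rewrite /quasilin mdistxx mul0r; lra.
have [<-|cd] := eqVneq c d; first by rewrite /quasilin mdistxx mulr0; lra.
rewrite -mdist_gt0 in ab; rewrite -mdist_gt0 in cd.
(* the point of the diagonal [b, c] dividing it in the ratio d(a,b) : d(c,d) *)
have [[geoX _] e_gt0] := (@cat0_subproof R X, addr_gt0 ab cd).
have [g gbc] := geoX b c.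
pose t := mdist a b / (mdist a b + mdist c d).
have tE : t * (mdist a b + mdist c d) = mdist a b by rewrite divfK// gt_eqF.
have t0 : 0 < t by rewrite divr_gt0.
have t1 : t < 1 by rewrite ltr_pdivrMr// mul1r ltrDl.
have t01 : 0 <= t <= 1 by rewrite !ltW.
have ha := cat0_cn a gbc t01; have hd := cat0_cn d gbc t01.
have tri := metric_triangle a (g t) d.
rewrite (metric_sym (g t)) in tri.
move: ha hd tri (mdist_ge0 a (g t)) (mdist_ge0 d (g t)) (mdist_ge0 a d).
rewrite /quasilin (metric_sym d b) (metric_sym d c).
set AB := mdist a b in ab e_gt0 t tE t0 t1 t01 *.
set CD := mdist c d in cd e_gt0 t tE t0 t1 t01 *.
set AM := mdist a (g t); set DM := mdist d (g t).
set AC := mdist a c; set BD := mdist b d; set BC := mdist b c; set AD := mdist a d.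
move=> ha hd tri am dm ad.
have s0 : 0 < 1 - t by rewrite subr_gt0.
have sE : (1 - t) * AB = t * CD by lra.
have hAD : t * (1 - t) * AD ^+ 2 <= (1 - t) * AM ^+ 2 + t * DM ^+ 2.
  have : AD ^+ 2 <= (AM + DM) ^+ 2.
    by rewrite ler_sqr// nnegrE// addr_ge0.
  move=> /(ler_wpM2l (ltW (mulr_gt0 t0 s0))) /le_trans; apply.
  rewrite -subr_ge0.
  have -> : (1 - t) * AM ^+ 2 + t * DM ^+ 2 - t * (1 - t) * (AM + DM) ^+ 2 =
    ((1 - t) * AM - t * DM) ^+ 2 by ring.
  exact: sqr_ge0.
rewrite -(ler_pM2l (mulr_gt0 t0 s0)).
have E1 : (1 - t) * ((1 - t) * AB ^+ 2) = t * (1 - t) * (AB * CD).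
  by transitivity ((1 - t) * AB * ((1 - t) * AB)); [ring|rewrite {2}sE; ring].
have E2 : t * (t * CD ^+ 2) = t * (1 - t) * (AB * CD).
  by transitivity (t * CD * (t * CD)); [ring|rewrite -{1}sE; ring].
have ha' := ler_wpM2l (ltW s0) ha; have hd' := ler_wpM2l (ltW t0) hd.
lra.
Qed.

End cat0_theory.

Section lindual.
Context {R : realType}.
Implicit Type X : hadamardType R.

(* The class [t ab], identified with the function (x, y) |-> t <ab, xy>. *)
Definition dual_class X (t : R) (a b : X) : X * X -> R^o :=
  fun xy => t * quasilin a b xy.1 xy.2.

Definition metric_dual X : set (X * X -> R^o) :=
  [set f | exists t a b, f = dual_class t a b].

Definition in_lindual X : {pred (X * X -> R^o)} := fun f =>
  `[< exists n (alpha : 'I_n -> R) (f_ : 'I_n -> X * X -> R^o),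
      (forall i, metric_dual (f_ i)) /\ f = \sum_(i < n) alpha i *: f_ i >].
Arguments in_lindual : clear implicits.

(* Elements of the linear dual with the same action are equal, so the linear
   dual is a space of functions on X * X. *)
Record lindual X := LinDual {
  lindual_fun :> X * X -> R^o ;
  lindual_subproof : lindual_fun \in in_lindual X }.

HB.instance Definition _ X := [isSub for @lindual_fun X].
HB.instance Definition _ X := [Choice of lindual X by <:].

Lemma in_lindualP X : submod_closed (in_lindual X).
Proof.
split; first by apply/asboolP; exists 0, (fun=> 0), (fun=> 0); split => [[]//|];
  rewrite big_ord0.
move=> a f g /asboolP[n [al [f_ [Hf ->]]]] /asboolP[m [be [g_ [Hg ->]]]].
apply/asboolP; exists (n + m)%N.
exists (fun i => match fintype.split i with inl j => a * al j | inr j => be j end).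
exists (fun i => match fintype.split i with inl j => f_ j | inr j => g_ j end).
split=> [i|]; first by case: fintype.split.
rewrite big_split_ord/= scaler_sumr; congr (_ + _); apply: eq_bigr => i _.
  by rewrite (unsplitK (inl i : 'I_n + 'I_m)) scalerA.
by rewrite (unsplitK (inr i : 'I_n + 'I_m)).
Qed.

HB.instance Definition _ X :=
  GRing.isSubmodClosed.Build R (X * X -> R^o) (in_lindual X) (in_lindualP X).
HB.instance Definition _ X := [SubChoice_isSubLmodule of lindual X by <:].

Definition lindual_norm X (f : lindual X) : R :=
  sup [set r | exists a b c d : X, (a, c) <> (b, d) /\
         r = `|f (a, b) - f (c, d)| / (mdist a b + mdist c d)].

Lemma lindualD X (f g : lindual X) xy : (f + g) xy = f xy + g xy.
Proof. by []. Qed.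

Lemma lindualZ X l (f : lindual X) xy : (l *: f) xy = l * f xy.
Proof. by []. Qed.

Lemma lindual_eqP X (f g : lindual X) : (forall x y, f (x, y) = g (x, y)) -> f = g.
Proof. by move=> fg; apply/val_inj/funext => -[x y]; exact: fg. Qed.

Lemma lindual_bound X (f : lindual X) :
  exists2 M, 0 <= M & forall a b, `|f (a, b)| <= M * mdist a b.
Proof.
case: f => f /[dup] /asboolP[n [al [f_ [Hf fE]]]] fP /=.
suff : exists2 M : R, 0 <= M & forall a b : X,
    `|(\sum_(i < n) al i *: f_ i) (a, b)| <= M * mdist a b.
  by rewrite -fE.
elim/big_ind : _ {f fP fE} => [|u v [M M0 uM] [N N0 vN]|i _].
- by exists 0 => // a b; rewrite normr0 mul0r.
- exists (M + N) => [|a b]; first exact: addr_ge0.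
  by rewrite mulrDl (le_trans (ler_normD _ _))// lerD.
- have [t [c [d ->]]] := Hf i.
  exists (`|al i| * (`|t| * mdist c d)) => [|a b].
    by rewrite !mulr_ge0// mdist_ge0.
  have -> : (al i *: dual_class t c d) (a, b) = al i * (t * quasilin c d a b) :> R.
    by [].
  rewrite 2!normrM -!mulrA; do 2 apply: ler_wpM2l => //.
  exact: quasilin_CS.
Qed.

Lemma mdist2_gt0 X (a b c d : X) : (a, c) <> (b, d) ->
  0 < mdist a b + mdist c d.
Proof.
move=> abcd; rewrite lt_neqAle addr_ge0 ?mdist_ge0// andbT eq_sym.
rewrite paddr_eq0 ?mdist_ge0//; apply/negP => /andP[/eqP ab /eqP cd].
by apply: abcd; rewrite (mdist_positivity _ _ ab) (mdist_positivity _ _ cd).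
Qed.

Lemma lindual_norm_ubound X (f : lindual X) :
  has_ubound [set r | exists a b c d : X, (a, c) <> (b, d) /\
         r = `|f (a, b) - f (c, d)| / (mdist a b + mdist c d)].
Proof.
have [M M0 fM] := lindual_bound f; exists M => _ [a [b [c [d [abcd ->]]]]].
rewrite ler_pdivrMr ?mdist2_gt0// mulrDr (le_trans (ler_normB _ _))//.
by rewrite lerD.
Qed.

Lemma lindual_norm_ge X (f : lindual X) (a b c d : X) : (a, c) <> (b, d) ->
  `|f (a, b) - f (c, d)| / (mdist a b + mdist c d) <= lindual_norm f.
Proof.
move=> abcd; apply: (ub_le_sup (lindual_norm_ubound f)).
by exists a, b, c, d.
Qed.

Lemma lindual_norm_le X (f : lindual X) M : 0 <= M ->
  (forall a b c d : X, (a, c) <> (b, d) ->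
    `|f (a, b) - f (c, d)| / (mdist a b + mdist c d) <= M) ->
  lindual_norm f <= M.
Proof.
move=> M0 fM; rewrite /lindual_norm.
set S := [set _ | _]; have [->|S0] := eqVneq S set0; first by rewrite sup0.
by apply: ge_sup => [|_ [a [b [c [d [abcd ->]]]]]]; [exact/set0P|exact: fM].
Qed.

Lemma lindual_norm_ge0 X (f : lindual X) : 0 <= lindual_norm f.
Proof.
rewrite /lindual_norm.
set S := [set _ | _]; have [->|/set0P[r Sr]] := eqVneq S set0.
  by rewrite sup0.
apply: (le_trans _ (ub_le_sup (lindual_norm_ubound f) Sr)).
case: Sr => [a [b [c [d [_ ->]]]]].
by rewrite divr_ge0// addr_ge0// mdist_ge0.
Qed.

Lemma lindual_normD X (f g : lindual X) :
  lindual_norm (f + g) <= lindual_norm f + lindual_norm g.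
Proof.
apply: lindual_norm_le => [|a b c d abcd].
  by rewrite addr_ge0// lindual_norm_ge0.
apply: le_trans (lerD (lindual_norm_ge f abcd) (lindual_norm_ge g abcd)).
rewrite -mulrDl ler_pM2r ?invr_gt0 ?mdist2_gt0// !lindualD.
by rewrite opprD addrACA ler_normD.
Qed.

Lemma lindual_normZ_le X l (f : lindual X) :
  lindual_norm (l *: f) <= `|l| * lindual_norm f.
Proof.
apply: lindual_norm_le => [|a b c d abcd].
  by rewrite mulr_ge0// lindual_norm_ge0.
rewrite !lindualZ -mulrBr normrM -mulrA ler_wpM2l//.
exact: lindual_norm_ge.
Qed.

Lemma lindual_normZ X l (f : lindual X) :
  lindual_norm (l *: f) = `|l| * lindual_norm f.
Proof.
apply/eqP; rewrite eq_le lindual_normZ_le/=.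
have [->|l0] := eqVneq l 0; first by rewrite normr0 mul0r lindual_norm_ge0.
rewrite mulrC -ler_pdivlMr ?normr_gt0// mulrC -normfV.
by have := lindual_normZ_le l^-1 (l *: f); rewrite scalerA mulVf// scale1r.
Qed.

Lemma lindual_norm0_eq0 X (f : lindual X) : lindual_norm f = 0 -> f = 0.
Proof.
move=> f0; apply: lindual_eqP => x y; rewrite [RHS](_ : _ = 0)//.
have [M M0 fM] := lindual_bound f.
have fxx z : f (z, z) = 0.
  by apply/eqP; rewrite -normr_le0; have := fM z z; rewrite mdistxx mulr0.
have [->|xy] := eqVneq x y; first exact: fxx.
have ne : (x, x) <> (y, x) by case=> /eqP; rewrite (negPf xy).
have := lindual_norm_ge f ne; rewrite f0 fxx subr0 mdistxx addr0.
rewrite ler_pdivrMr ?mdist_gt0// mul0r normr_le0.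
by move/eqP.
Qed.

HB.instance Definition _ X := Lmodule_isNormed.Build R (lindual X)
  (@lindual_normD X) (@lindual_normZ X) (@lindual_norm0_eq0 X).

End lindual.

Section fenchel.
Context {R : realType} {X : hadamardType R}.
Implicit Types (h : X * lindual X -> \bar R) (p : X).
Local Open Scope ereal_scope.

Definition eproper h : Prop :=
  (forall z, h z <> -oo) /\ exists z, h z <> +oo.

Definition elsc h : Prop :=
  closed [set w : (X * lindual X) * R | h w.1 <= w.2%:E].

(* The library convention +oo + -oo = -oo plays no role: [econvex] is only used
   together with [eproper]. *)
Definition econvex h : Prop :=
  forall (x y : X) (f g : lindual X) (l : R), (0 <= l <= 1)%R ->
    h (geo x y l, (1 - l) *: f + l *: g)%R <=
    (1 - l)%:E * h (x, f) + l%:E * h (y, g).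

Definition Gamma : set (X * lindual X -> \bar R) :=
  [set h | [/\ eproper h, elsc h & econvex h]].

Definition coupling p (z : X * lindual X) : R := z.2 (p, z.1).

Definition indicator (A : set (X * lindual X)) (z : X * lindual X) : \bar R :=
  if z \in A then 0 else +oo.

Definition fenchel_conj p h (w : lindual X * X) : \bar R :=
  ereal_sup [set (w.1 (p, z.1) + z.2 (p, w.2))%:E - h z
            | z in [set: X * lindual X]].

Definition below_coupling p h : set (X * lindual X) :=
  [set z | h z <= (coupling p z)%:E].

Definition Gamma_dual p : set (X * lindual X -> \bar R) :=
  [set h | Gamma h /\ forall (x : X) (f : lindual X),
     h (x, f) =
     fenchel_conj p (fun z => h z + indicator (below_coupling p h) z) (f, x)].

End fenchel.

Section monotone.
Context {R : realType} {X : hadamardType R}.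
Implicit Types T S : X -> set (lindual X).

Definition graph T : set (X * lindual X) := [set z | T z.1 z.2].

Definition monotone T : Prop := forall x y (f g : lindual X),
  graph T (x, f) -> graph T (y, g) -> 0 <= (f - g) (y, x).

Definition maximal_monotone : set (X -> set (lindual X)) :=
  [set T | monotone T /\ ~ exists S, monotone S /\ graph T `<` graph S].

End monotone.
Arguments maximal_monotone {R} X.

(* Main.v *)
(** The bijection sends T to its Fitzpatrick function
      phi_T (x, f) = sup over (y, g) in gra T of <f, py> + <g, px> - <g, py>.
    By Chasles' relation phi_T (x, f) - <f, px> is the supremum of
    - <f - g, yx>, so {phi_T <= pi_p} is the set of points monotonically related
    to gra T, and T is maximal monotone iff gra T = {phi_T <= pi_p}; this gives
    injectivity, and phi_T in Gamma_p because flatness makes x |-> <g, px>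
    affine. Conversely, if h = (h + iota_A)_p o r for A = {h <= pi_p}, then
    testing the supremum on the diagonal gives h = pi_p on A, so h = phi_A and
    A = {phi_A <= pi_p} is the graph of a maximal monotone operator. *)
Require Import Defs.
From mathcomp Require Import all_boot all_order all_algebra.
From mathcomp Require Import ring lra.
From mathcomp Require Import all_classical all_reals all_analysis.

Set Implicit Arguments.
Unset Strict Implicit.
Unset Printing Implicit Defensive.

Import Order.TTheory GRing.Theory Num.Theory.
Import numFieldNormedType.Exports.

Local Open Scope classical_set_scope.
Local Open Scope ring_scope.

(** * Functionals of the linear dual: behaviour along geodesics and continuity *)

Section lindual_action.
Context {R : realType} {X : hadamardType R}.
Implicit Types (x y : X) (f g : lindual X).

(** Functionals are finite combinations of quasilinearizations, so a relation linear in the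
    functional reduces to an identity between squared distances. *)
Lemma lindual_ind (P : (X * X -> R^o) -> Prop) :
  P 0 -> (forall u v, P u -> P v -> P (u + v)) ->
  (forall l u, P u -> P (l *: u)) ->
  (forall a b, P (fun xy => quasilin a b xy.1 xy.2)) ->
  forall f, P f.
Proof.
move=> P0 PD PZ Pq [f /[dup] /asboolP[n [al [f_ [Hf fE]]]] fP] /=.
rewrite fE; elim/big_ind : _ => [||i _]; [exact: P0|exact: PD|].
by apply: (PZ); have [t [a [b ->]]] := Hf i; exact: (PZ).
Qed.

Lemma lindual_chasles p f x y : f (x, y) = f (p, y) - f (p, x).
Proof.
move: f; apply: (@lindual_ind (fun u => u (x, y) = u (p, y) - u (p, x)))
  => [|u v|l u|a b].
- by rewrite subrr.
- by rewrite !fctE => -> ->; rewrite opprD addrACA.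
- by rewrite !fctE => ->; rewrite -mulrBr.
- by rewrite /quasilin/=; lra.
Qed.

Lemma lindual_subC f g x y : (f - g) (x, y) = (g - f) (y, x).
Proof.
rewrite (lindual_chasles y) [(f - g) (y, y)](lindual_chasles y) subrr sub0r.
exact: opprB.
Qed.

(** Flatness makes the squared distance to a point affine along the geodesic up to
    [t * (1 - t) * mdist x y ^+ 2]; this term does not depend on the point, so it cancels in
    [quasilin]. *)
Lemma lindual_geo f p x y t : flat X -> 0 <= t <= 1 ->
  f (p, geo x y t) = (1 - t) * f (p, x) + t * f (p, y).
Proof.
move=> flatX t01; move: f; apply: (@lindual_ind (fun u =>
  u (p, geo x y t) = (1 - t) * u (p, x) + t * u (p, y))) => [|u v|l u|a b].
- by rewrite /= !mulr0 addr0.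
- by rewrite !fctE => -> ->; ring.
- by rewrite !fctE => ->; rewrite /GRing.scale/=; ring.
- by rewrite /quasilin/= !flatX//; ring.
Qed.

Lemma lindual_le_norm f x y : `|f (x, y)| <= `|f| * mdist x y.
Proof.
have fxx z : f (z, z) = 0 by rewrite (lindual_chasles z) subrr.
have [->|xy] := eqVneq x y; first by rewrite fxx normr0 mdistxx mulr0.
(* The second pair in the quotient defining the norm is taken to be [(x, x)], where [f] vanishes. *)
have ne : (x, x) <> (y, x) by case=> /eqP; rewrite (negPf xy).
have := lindual_norm_ge f ne; rewrite fxx subr0 mdistxx addr0.
by rewrite ler_pdivrMr ?mdist_gt0.
Qed.

Lemma lindual_continuous f p : continuous (fun x => f (p, x)).
Proof.
move=> x; apply/cvgrPdist_lt => e e0.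
(* The added 1 keeps the divisor of [e] positive even if [f] has norm 0. *)
have M0 : 0 < `|f| + 1 by rewrite ltr_wpDl.
near=> y.
rewrite -(lindual_chasles p) (le_lt_trans (lindual_le_norm _ _ _))//.
apply: (@le_lt_trans _ _ ((`|f| + 1) * mdist y x)).
  by rewrite ler_wpM2r ?mdist_ge0// lerDl.
rewrite mulrC -ltr_pdivlMr// metric_sym.
have : ball x (e / (`|f| + 1)) y.
  by near: y; apply: nbhsx_ballx; rewrite divr_gt0.
by rewrite ballEmdist.
Unshelve. all: by end_near. Qed.

Lemma lindual_eval_continuous x y : continuous (fun f : lindual X => f (x, y)).
Proof.
move=> f; apply/(@cvgrPdist_lt _ _ _ _ (nbhs_filter f)) => e e0.
have M0 : 0 < mdist x y + 1 by rewrite ltr_wpDl// mdist_ge0.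
near=> g.
have -> : f (x, y) - g (x, y) = (f - g) (x, y) by [].
rewrite (le_lt_trans (lindual_le_norm _ _ _))//.
apply: (@le_lt_trans _ _ (`|f - g| * (mdist x y + 1))).
  by rewrite ler_wpM2l// lerDl.
rewrite -ltr_pdivlMr//.
have : ball f (e / (mdist x y + 1)) g.
  by near: g; apply: nbhsx_ballx; rewrite divr_gt0.
by rewrite -ball_normE.
Unshelve. all: by end_near. Qed.

End lindual_action.

(** * The Fitzpatrick function of a set of pairs *)

Section fitzpatrick.
Context {R : realType} {X : hadamardType R}.
Context (p : X).
Implicit Types (A : set (X * lindual X)) (h : X * lindual X -> \bar R).
Implicit Types (z w : X * lindual X) (T S : X -> set (lindual X)).
Local Open Scope ereal_scope.

Definition fitzpatrick A z : \bar R :=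
  ereal_sup [set (z.2 (p, w.1) + w.2 (p, z.1) - coupling p w)%:E | w in A].

Lemma fitzpatrick_ge A z w : A w ->
  (z.2 (p, w.1) + w.2 (p, z.1) - coupling p w)%:E <= fitzpatrick A z.
Proof. by move=> Aw; apply: ereal_sup_ubound; exists w. Qed.

Lemma fitzpatrick_le_couplingP A z :
  fitzpatrick A z <= (coupling p z)%:E <->
  forall w, A w -> (0 <= (z.2 - w.2) (w.1, z.1))%R.
Proof.
have E w : ((z.2 - w.2) (w.1, z.1) =
    coupling p z - (z.2 (p, w.1) + w.2 (p, z.1) - coupling p w))%R.
  have -> : ((z.2 - w.2) (w.1, z.1) = z.2 (w.1, z.1) - w.2 (w.1, z.1))%R by [].
  by rewrite !(lindual_chasles p _ w.1) /coupling; ring.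
split=> [Fz w Aw|Az].
  by rewrite E subr_ge0 -lee_fin (le_trans (fitzpatrick_ge _ Aw)).
by apply: ge_ereal_sup => _ [w Aw <-]; rewrite lee_fin -subr_ge0 -E Az.
Qed.

(** A point monotonically related to the graph can be adjoined to it, so maximality already puts it
    there; conversely, every point of a monotone extension is related to the graph. *)
Lemma maximal_monotoneP T :
  maximal_monotone X T <-> graph T = below_coupling p (fitzpatrick (graph T)).
Proof.
split=> [[monT maxT]|TE].
  apply/seteqP; split=> [[x f] Tz|[x f] /fitzpatrick_le_couplingP Tz].
    by apply/fitzpatrick_le_couplingP => -[y g] Tw; exact: monT.
  have [//|nTz] := pselect (graph T (x, f)); case: maxT.
  exists (fun y => T y `|` [set g | (y, g) = (x, f)]); split; last first.
    split=> [w Tw|sub]; first by left.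
    by apply: nTz; apply: sub; right.
  move=> y1 y2 g1 g2 [T1|[-> ->]] [T2|[-> ->]].
  - exact: monT.
  - by rewrite lindual_subC; exact: (Tz _ T1).
  - exact: (Tz _ T2).
  - by rewrite subrr.
have monT : Defs.monotone T.
  move=> x y f g; rewrite {1}TE => /fitzpatrick_le_couplingP Tz Tw.
  exact: (Tz _ Tw).
split=> // -[S [monS [TS]]]; apply => -[x f] Sz.
rewrite TE; apply/fitzpatrick_le_couplingP => -[y g] /TS Sw; exact: monS.
Qed.

Lemma fenchel_conj_indicator h A z :
  (forall w, h w <> -oo) -> (forall w, A w -> h w = (coupling p w)%:E) ->
  fenchel_conj p (fun w => h w + indicator A w) (z.2, z.1) = fitzpatrick A z.
Proof.
move=> hNy hA; apply/eqP; rewrite eq_le; apply/andP; split.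
  apply: ge_ereal_sup => _ [w _ <-]; rewrite /indicator.
  case: ifPn => [/set_mem Aw|_].
    by rewrite adde0 hA// -EFinB; exact: fitzpatrick_ge.
  (* Off [A] the sum is +oo because [h] avoids -oo, so the term is -oo. *)
  by rewrite addey ?leNye//; exact/eqP.
apply: ge_ereal_sup => _ [w Aw <-]; apply: ereal_sup_ubound; exists w => //.
by rewrite /indicator mem_set// adde0 hA.
Qed.

(** The epigraph of a supremum is the intersection of the epigraphs of its terms, which are
    continuous here. *)
Lemma fitzpatrick_lsc A : elsc (fitzpatrick A).
Proof.
rewrite /elsc.
have -> : [set w : (X * lindual X) * R | fitzpatrick A w.1 <= w.2%:E] =
    \bigcap_(w in A) [set v : (X * lindual X) * R |
      (v.1.2 (p, w.1) + w.2 (p, v.1.1) - coupling p w - v.2 <= 0)%R].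
  apply/seteqP; split=> [v Fv w Aw|v Av] /=.
    by rewrite subr_le0 -lee_fin (le_trans (fitzpatrick_ge _ Aw)).
  apply: ge_ereal_sup => _ [w Aw <-]; rewrite lee_fin -subr_le0; exact: Av.
apply: closed_bigI => w _.
apply: (@closed_comp _ _ _ [set x : R | x <= 0]%R); last exact: closed_le.
move=> v _.
apply: cvgB; last exact: cvg_snd.
apply: cvgB; last exact: cvg_cst.
apply: cvgD.
- apply: (@cvg_comp _ _ _ (fun v : (X * lindual X) * R => v.1.2)
    (fun f : lindual X => f (p, w.1))); last exact: lindual_eval_continuous.
  by apply: cvg_comp; [exact: cvg_fst|exact: cvg_snd].
- apply: (@cvg_comp _ _ _ (fun v : (X * lindual X) * R => v.1.1)
    (fun x : X => w.2 (p, x))); last exact: lindual_continuous.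
  by apply: cvg_comp; [exact: cvg_fst|exact: cvg_fst].
Qed.

(** Each term is affine along geodesics by [lindual_geo], and a supremum of such terms is convex. *)
Lemma fitzpatrick_convex A : flat X -> econvex (fitzpatrick A).
Proof.
move=> flatX x y f g l /[dup] l01 /andP[l0 l1].
apply: ge_ereal_sup => _ [w Aw <-] /=.
rewrite [X in (X + _ - _)%R](_ : _ =
  (1 - l) * f (p, w.1) + l * g (p, w.1))%R// lindual_geo//.
set a := (f (p, w.1) + w.2 (p, x) - coupling p w)%R.
set b := (g (p, w.1) + w.2 (p, y) - coupling p w)%R.
apply: (@le_trans _ _ ((1 - l)%:E * a%:E + l%:E * b%:E)).
  by rewrite -!EFinM -EFinD lee_fin /a /b; lra.
by apply: leeD; apply: lee_wpmul2l; rewrite ?lee_fin ?subr_ge0//;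
  exact: (fitzpatrick_ge (_, _) Aw).
Qed.

Lemma fitzpatrick_proper A z : A z -> fitzpatrick A z <= (coupling p z)%:E ->
  eproper (fitzpatrick A).
Proof.
move=> Az Fz; split=> [w|].
  by apply/eqP; rewrite -ltNye (lt_le_trans _ (fitzpatrick_ge _ Az))// ltNyr.
by exists z; apply/eqP; rewrite -ltey (le_lt_trans Fz)// ltry.
Qed.

(** For empty [A] the supremum is -oo, which puts every point in [below_coupling]; [(p, 0)] is an
    arbitrary choice. *)
Lemma fitzpatrick_graph_neq0 A :
  A = below_coupling p (fitzpatrick A) -> exists z, A z.
Proof.
move=> AE; have [//|A0] := pselect (exists z, A z).
exists (p, 0%R : lindual X); rewrite AE; apply/fitzpatrick_le_couplingP => w Aw.
by case: A0; exists w.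
Qed.

Lemma fitzpatrick_eq_coupling A w : A = below_coupling p (fitzpatrick A) ->
  A w -> fitzpatrick A w = (coupling p w)%:E.
Proof.
move=> AE Aw; apply/eqP; rewrite eq_le; apply/andP; split.
  by move: Aw; rewrite {1}AE.
(* The term of [w] itself is twice the coupling minus the coupling. *)
by apply: (le_trans _ (fitzpatrick_ge w Aw)); rewrite lee_fin /coupling addrK.
Qed.

Lemma Gamma_dual_fitzpatrick A : flat X ->
  A = below_coupling p (fitzpatrick A) -> Gamma_dual p (fitzpatrick A).
Proof.
move=> flatX AE; have [z Az] := fitzpatrick_graph_neq0 AE.
have Fz : fitzpatrick A z <= (coupling p z)%:E.
  by rewrite (fitzpatrick_eq_coupling AE).
have pF := fitzpatrick_proper Az Fz; split=> [|x f].
  by split; [exact: pF|exact: fitzpatrick_lsc|exact: fitzpatrick_convex].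
rewrite -AE (fenchel_conj_indicator (x, f))//; first exact: pF.1.
by move=> w; exact: fitzpatrick_eq_coupling.
Qed.

Lemma Gamma_dualE h : Gamma_dual p h -> h = fitzpatrick (below_coupling p h).
Proof.
move=> [[[hNy _] _ _] hE]; set A := below_coupling p h.
apply/funext => -[x f]; rewrite hE (fenchel_conj_indicator (x, f))// => -[y g].
move=> Aw; apply/eqP; rewrite eq_le Aw/=.
move: (hNy (y, g)) (hE y g) (Aw); rewrite /A /below_coupling /=.
case hr : (h (y, g)) => [r| |] // _ rE rle.
(* With [c] the coupling at [(y, g)], the term of this point itself gives [2 * c - r <= r], so
   [c <= r]. *)
have : (g (p, y) + g (p, y))%:E - h (y, g) <= r%:E.
  rewrite rE; apply: ereal_sup_ubound; exists (y, g) => //.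
  by rewrite /indicator mem_set// adde0.
by rewrite hr -EFinB !lee_fin /coupling/=; lra.
Qed.

End fitzpatrick.

Theorem corollary5p17 (R : realType) (X : hadamardType R) (p : X) :
  flat X ->
  exists F : (X -> set (lindual X)) -> (X * lindual X -> \bar R),
    set_bij (maximal_monotone X) (Gamma_dual p) F.
Proof.
move=> flatX; exists (fun T => fitzpatrick p (graph T)); split.
- by move=> T /(maximal_monotoneP p); exact: Gamma_dual_fitzpatrick.
- move=> T S /set_mem/(maximal_monotoneP p) TE /set_mem/(maximal_monotoneP p) SE.
  (* The function determines the graph, as the set where it is at most the coupling. *)
  move=> FE; have {FE TE SE} TS : graph T = graph S by rewrite TE FE -SE.
  apply/funext => x; apply/funext => f.
  exact: (congr1 (fun G : set _ => G (x, f)) TS).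
- move=> h hG; have hE := Gamma_dualE hG.
  (* Since [h] is the Fitzpatrick function of [below_coupling p h], the operator with this graph is
     its preimage. *)
  exists (fun x => [set f | below_coupling p h (x, f)]); last first.
    rewrite [RHS]hE; congr fitzpatrick.
    by apply/seteqP; split=> -[].
  apply/(maximal_monotoneP p).
  have -> : graph (fun x => [set f | below_coupling p h (x, f)]) =
    below_coupling p h by apply/seteqP; split=> -[].
  by rewrite -hE.
Qed.
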